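(* Let $(M,g)$ be a strongly causal generalized plane wave, $M=M_0\times\mathbb R^2$, $g=g_0+2\,du\,dv+H(x,u)\,du^2$, with $(M_0,g_0)$ geodesically complete. If $(M,g)$ is geodesically complete and all the null rays $\gamma_{\overline x,\overline u}$, $(\overline x,\overline u)\in M_0\times\mathbb R$, are future-regular, then $(M,g)$ does not contain black holes, i.e. $B^+=\emptyset$. In particular, every causally continuous, geodesically complete generalized plane wave has no black holes ($B^+=\emptyset$).
   Context: **Generalized plane waves.** A generalized plane wave is a spacetime $(M^{n+1},g)$ with $M=M_0\times\mathbb R^2$ and $g=g_0+2\,du\,dv+H(x,u)\,du^2$, where $g_0$ is a smooth Riemannian metric on the (connected) $(n-1)$-dimensional manifold $M_0$, $(v,u)$ are the standard coordinates of $\mathbb R^2$ and $H:M_0\times\mathbb R\to\mathbb R$ is smooth. The time orientation is the one making the null parallel field $\partial_v$ past-directed. Standing assumption: $(M_0,g_0)$ is geodesically complete. For $(\overline x,\overline u)\in M_0\times\mathbb R$, $\gamma_{\overline x,\overline u}(s)=(\overline x,-s,\overline u)$, $s\in\mathbb R$ (coordinates ordered $(x,v,u)$); it is a future-directed null geodesic line. **Basic notions.** A spacetime is a connected, time-oriented $C^\infty$ Lorentzian manifold (signature $(-,+,\dots,+)$), here assumed strongly causal. $\ll$ is the chronological relation, $I^\pm$, $J^\pm$ chronological/causal futures and pasts. Causally continuous has its standard meaning (distinguishing and reflecting). **c-completion.** A non-empty $P\subset M$ is a past set if $P=I^-(P)$; it is an indecomposable past set (IP) if it is not the union of two proper subsets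 that are past sets. IFs (indecomposable future sets) are defined dually. For $S\subset M$: $\downarrow S:=I^-(\{p: p\ll q\ \forall q\in S\})$, $\uparrow S:=I^+(\{p: q\ll p\ \forall q\in S\})$. $\hat M$ (resp. $\check M$) is the set of all IPs (resp. IFs). $P\sim_S F$ means: $P$ is a maximal (for inclusion) IP inside $\downarrow F$ and $F$ is a maximal IF inside $\uparrow P$. The c-completion $\overline M$ is the set of pairs $(P,F)$, $P\in\hat M\cup\{\emptyset\}$, $F\in\check M\cup\{\emptyset\}$, such that either $P,F\ne\emptyset$ and $P\sim_SF$; or $P=\emptyset$, $F\neq\emptyset$ and no $P'\ne\emptyset$ has $P'\sim_SF$; or $F=\emptyset$, $P\ne\emptyset$ and no $F'\neq\emptyset$ has $P\sim_SF'$. $M$ is identified with $\{(I^-(p),I^+(p)):p\in M\}$, and the c-boundary is $\partial M:=\overline M\setminus M$. **Endpoints.** For a sequence of sets, $\mathrm{LI}(A_n)=\bigcup_n\bigcap_{k\ge n}A_k$, $\mathrm{LS}(A_n)=\bigcap_n\bigcup_{k\ge n}A_k$. For IPs, $P\in\hat L(\{P_n\})$ iff $P\subset\mathrm{LI}(P_n)$ and $P$ is a maximal IP in $\mathrm{LS}(P_n)$; $\check L$ is defined dually for IFs. $(P,F)\in L(\{(P_n,F_n)\})$ iff ($P\in\hat L(\{P_n\})$ if $P\ne\emptyset$) and ($F\in\check L(\{F_n\})$ if $F\neq\emptyset$). The chronological topology on $\overline M$: $C$ is closed iff $L(\sigma)\subset C$ for every sequence $\sigma$ in $C$. Standing assumption: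 $L$ is of first order, i.e. $x\in L(\sigma)$ iff $\sigma$ converges to $x$ in this topology. $(P,F)\in\overline M$ is a future endpoint of a future-directed causal curve $\gamma:[a,b)\to M$ if $(P,F)\in L(\{\gamma(t_n)\})$ for every increasing sequence $t_n\nearrow b$. **Null infinity and black hole.** A null (geodesic) ray is an achronal future-inextendible future-directed null geodesic. A future-inextendible causal curve $\gamma$ is future-regular if $\uparrow\gamma=\uparrow I^-(\gamma)$. The future null infinity $\mathcal J^+$ is the set of $(P,F)\in\partial M$ such that (i) there is a future-complete and future-regular null ray $\eta:[0,+\infty)\to M$ with future endpoint $(P,F)$, and (ii) every future-inextendible null geodesic with future endpoint $(P,F)$ is future-complete. $p\in M$ is visible from infinity if some future-inextendible null geodesic starting at $p$ has a future endpoint in $\mathcal J^+$; $V_\infty$ is the set of such points. The black hole region (defined when $\mathcal J^+\neq\emptyset$) is $B^+:=M\setminus J^-(V_\infty)$. *)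

(* Defs.v *)
From Stdlib Require Import Relation_Operators.
From HB Require Import structures.
From mathcomp Require Import all_boot all_order all_algebra.
From mathcomp Require Import all_classical all_reals all_analysis.
Import Order.TTheory GRing.Theory Num.Theory.
Import numFieldNormedType.Exports.

Set Implicit Arguments.
Unset Strict Implicit.
Unset Printing Implicit Defensive.

Local Open Scope classical_set_scope.
Local Open Scope ring_scope.

(* The c-completion depends on the spacetime only through its chronological   *)
(* relation, so this part is stated for a relation ll (read "p << q").        *)
Section CCompletion.
Variables (T : Type) (ll : T -> T -> Prop).

Definition Ipast (S : set T) : set T := [set p | exists2 q, S q & ll p q].
Definition Ifuture (S : set T) : set T := [set p | exists2 q, S q & ll q p].

Definition past_set (P : set T) := P !=set0 /\ P = Ipast P.
Definition future_set (F : set T) := F !=set0 /\ F = Ifuture F.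

Definition IP : set (set T) := [set P | past_set P /\
  ~ exists P1 P2, [/\ past_set P1, past_set P2, P1 `<` P, P2 `<` P &
                      P = P1 `|` P2]].
Definition IF : set (set T) := [set F | future_set F /\
  ~ exists F1 F2, [/\ future_set F1, future_set F2, F1 `<` F, F2 `<` F &
                      F = F1 `|` F2]].

Definition common_past (S : set T) : set T :=
  Ipast [set p | forall q, S q -> ll p q].
Definition common_future (S : set T) : set T :=
  Ifuture [set p | forall q, S q -> ll q p].

Definition maximal_inside (C : set (set T)) (A P : set T) :=
  [/\ C P, P `<=` A & forall Q, C Q -> Q `<=` A -> P `<=` Q -> Q = P].

Definition S_related (P F : set T) :=
  maximal_inside IP (common_past F) P /\ maximal_inside IF (common_future P) F.

Definition completion : set (set T * set T) := [set x |
  [\/ S_related x.1 x.2,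
      [/\ x.1 = set0, IF x.2 & ~ exists P, S_related P x.2] |
      [/\ x.2 = set0, IP x.1 & ~ exists F, S_related x.1 F]]].

Definition point_pair (p : T) : set T * set T := (Ipast [set p], Ifuture [set p]).

Definition cboundary : set (set T * set T) := completion `\` range point_pair.

Definition LI (A : nat -> set T) : set T := \bigcup_n \bigcap_(k >= n) A k.
Definition LS (A : nat -> set T) : set T := \bigcap_n \bigcup_(k >= n) A k.

Definition Lhat (A : nat -> set T) (P : set T) :=
  P `<=` LI A /\ maximal_inside IP (LS A) P.
Definition Lcheck (A : nat -> set T) (F : set T) :=
  F `<=` LI A /\ maximal_inside IF (LS A) F.

Definition chr_limit (s : nat -> set T * set T) : set (set T * set T) :=
  [set x | [/\ completion x,
    x.1 !=set0 -> Lhat (fun n => (s n).1) x.1 &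
    x.2 !=set0 -> Lcheck (fun n => (s n).2) x.2]].

Definition chr_closed (C : set (set T * set T)) :=
  C `<=` completion /\ forall s, (forall n, C (s n)) -> chr_limit s `<=` C.

Definition chr_converges (s : nat -> set T * set T) (x : set T * set T) :=
  forall C, chr_closed C -> ~ C x -> \forall n \near \oo, ~ C (s n).

Definition first_order := forall s x, (forall n, completion (s n)) ->
  completion x -> (chr_limit s x <-> chr_converges s x).

Definition distinguishing := forall p q,
  (Ipast [set p] = Ipast [set q] -> p = q) /\
  (Ifuture [set p] = Ifuture [set q] -> p = q).

Definition reflecting := forall p q,
  Ifuture [set q] `<=` Ifuture [set p] <-> Ipast [set p] `<=` Ipast [set q].

Definition causally_continuous := distinguishing /\ reflecting.

Definition achronal (S : set T) := forall p q, S p -> S q -> ~ ll p q.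

Definition future_regular (S : set T) :=
  common_future S = common_future (Ipast S).

End CCompletion.

Section Smooth.
Variable R : realType.

(* C^oo on a set U (open in all uses): all iterated partial derivatives exist *)
(* and are continuous at every point of U.                                    *)
Definition smooth_on (m : nat) (W : normedModType R) (U : set 'rV[R]_m)
    (f : 'rV[R]_m -> W) :=
  forall (s : seq 'I_m) (y : 'rV[R]_m), U y ->
    let h := foldr (fun a h => 'D_(delta_mx 0 a) h) f s in
    {for y, continuous h} /\ forall a, derivable h y (delta_mx 0 a).

End Smooth.

(* The last field is the coordinate expression of the inverse of cmap; it is  *)
(* only meaningful on cmap @` cdom.                                           *)
Record chart (R : realType) (T : topologicalType) (m : nat) := Chart {
  cdom : set T;
  cmap : T -> 'rV[R]_m;
  cinv : 'rV[R]_m -> T }.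

Definition cimage R T m (c : chart R T m) : set 'rV[R]_m := cmap c @` cdom c.

Definition transition R T m (c d : chart R T m) (y : 'rV[R]_m) : 'rV[R]_m :=
  cmap d (cinv c y).

(* A space with an atlas indexed by idx and, for every chart, the matrix of a *)
(* metric in this chart as a function of the coordinates.  These are raw      *)
(* data; see riemannian_manifold for the axioms.                              *)
Record metric_space_data (R : realType) := MetricData {
  pts :> topologicalType;
  mdim : nat;
  idx : Type;
  atlas : idx -> chart R pts mdim;
  metric : idx -> 'rV[R]_mdim -> 'M[R]_mdim }.

Section Manifold.
Variables (R : realType) (N : metric_space_data R).
Local Notation m := (mdim N).
Implicit Types (i j : idx N) (p : N).

Definition smooth_atlas :=
  [/\ forall p, exists i, cdom (atlas i) p,
      forall i, open (cdom (atlas i)) /\ open (cimage (atlas i)),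
      forall i p, cdom (atlas i) p -> cinv (atlas i) (cmap (atlas i) p) = p,
      forall i, {within cdom (atlas i), continuous (cmap (atlas i))} /\
                {within cimage (atlas i), continuous (cinv (atlas i))} &
      forall i j, smooth_on (cmap (atlas i) @` (cdom (atlas i) `&` cdom (atlas j)))
                            (transition (atlas i) (atlas j))].

(* Vectors are rows, so the components of a vector change by v |-> v *m J,    *)
(* with J the Jacobian matrix of the change of coordinates.                   *)
Definition riemannian_metric :=
  [/\ forall i, smooth_on (cimage (atlas i)) (@metric R N i),
      forall i y, cimage (atlas i) y -> (metric i y)^T = metric i y,
      forall i y (v : 'rV[R]_m), cimage (atlas i) y -> v != 0 ->
        0 < (v *m metric i y *m v^T) 0 0 &
      forall i j p, cdom (atlas i) p -> cdom (atlas j) p ->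
        let y := cmap (atlas i) p in
        let J := jacobian (transition (atlas i) (atlas j)) y in
        metric i y = J *m metric j (cmap (atlas j) p) *m J^T].

Definition riemannian_manifold :=
  [/\ [set: N] !=set0, connected [set: N], hausdorff_space N,
      @second_countable N & smooth_atlas /\ riemannian_metric].

Definition coord_curve i (c : R -> N) (t : R) : 'rV[R]_m := cmap (atlas i) (c t).

Definition smooth_curve (U : set R) (c : R -> N) := forall t, U t ->
  {for t, continuous c} /\
  forall i k, cdom (atlas i) (c t) -> derivable (derive1n k (coord_curve i c)) t 1.

(* Curves are total functions of which only the restriction to J matters: c   *)
(* agrees on J with a curve d, smooth near J, whose derivatives satisfy the   *)
(* pointwise condition Q on J.  This gives one-sided derivatives at the end   *)
(* points of J.                                                               *)
Definition smooth_on_interval (Q : (R -> N) -> R -> Prop) (J : set R)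
    (c : R -> N) :=
  exists (U : set R) (d : R -> N),
    [/\ open U, J `<=` U, smooth_curve U d,
        forall t, J t -> c t = d t & forall t, J t -> Q d t].

Definition christoffel i (y : 'rV[R]_m) (k a b : 'I_m) : R :=
  let dg l r s := 'D_(delta_mx 0 l) (fun z => metric i z r s) y in
  2^-1 * \sum_l invmx (metric i y) k l * (dg a b l + dg b a l - dg l a b).

Definition geodesic_at (c : R -> N) (t : R) :=
  forall i, cdom (atlas i) (c t) ->
    let x := coord_curve i c in
    forall k, derive1n 2 x t 0 k +
      \sum_a \sum_b christoffel i (x t) k a b * derive1 x t 0 a * derive1 x t 0 b = 0.

Definition geodesic_on (J : set R) (c : R -> N) :=
  smooth_on_interval geodesic_at J c.

Definition geodesically_complete := forall (a b : \bar R) (c : R -> N),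
  (a < b)%E -> geodesic_on [set t | (a < t%:E)%E /\ (t%:E < b)%E] c ->
  exists d : R -> N, geodesic_on setT d /\
    forall t : R, (a < t%:E)%E -> (t%:E < b)%E -> d t = c t.

End Manifold.

(* A metric (here Lorentzian, signature (-,+,...,+)) together with the        *)
(* components in every chart of a nowhere zero future-directed causal vector  *)
(* field, which fixes the time orientation.                                   *)
Record spacetime_data (R : realType) := SpacetimeData {
  base :> metric_space_data R;
  orientation : idx base -> 'rV[R]_(mdim base) -> 'rV[R]_(mdim base) }.

Section Causality.
Variables (R : realType) (M : spacetime_data R).
Local Notation m := (mdim M).
Implicit Types (i : idx M) (c : R -> M) (p q : M).

Definition inner i (y v w : 'rV[R]_m) : R := (v *m metric i y *m w^T) 0 0.

(* A causal vector lies in the same cone as the causal vector X iff their     *)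
(* product is negative or both are null and v is a positive multiple of X.    *)
Definition future_vector i (y v : 'rV[R]_m) :=
  let X := orientation i y in
  inner i y v X < 0 \/ exists2 r : R, 0 < r & v = r *: X.

Definition timelike_at c t := forall i, cdom (atlas i) (c t) ->
  let y := coord_curve i c t in let v := derive1 (coord_curve i c) t in
  inner i y v v < 0 /\ future_vector i y v.

Definition causal_at c t := forall i, cdom (atlas i) (c t) ->
  let y := coord_curve i c t in let v := derive1 (coord_curve i c) t in
  [/\ v != 0, inner i y v v <= 0 & future_vector i y v].

Definition null_at c t := forall i, cdom (atlas i) (c t) ->
  let y := coord_curve i c t in let v := derive1 (coord_curve i c) t in
  [/\ v != 0, inner i y v v = 0 & future_vector i y v].

(* Piecewise smooth future-directed curves on [a, b], a < b: the transitive   *)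
(* closure glues finitely many smooth pieces.                                 *)
Definition timelike_curve c (a b : R) :=
  clos_trans R (fun s t => s < t /\ smooth_on_interval timelike_at `[s, t] c) a b.

Definition causal_curve c (a b : R) :=
  clos_trans R (fun s t => s < t /\ smooth_on_interval causal_at `[s, t] c) a b.

Definition chron p q :=
  exists c a b, [/\ timelike_curve c a b, c a = p & c b = q].

Definition causal p q :=
  p = q \/ exists c a b, [/\ causal_curve c a b, c a = p & c b = q].

Definition Jpast (S : set M) : set M := [set p | exists2 q, S q & causal p q].

Definition strongly_causal := forall p (U : set M), nbhs p U ->
  exists V : set M, [/\ nbhs p V, V `<=` U &
    forall c a b, causal_curve c a b -> V (c a) -> V (c b) ->
      forall t, a <= t <= b -> U (c t)].

(* The parameter interval [a, b) with b possibly infinite.                    *)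
Definition ico (a : R) (b : \bar R) : set R := [set t | a <= t /\ (t%:E < b)%E].

Definition null_geodesic c (a : R) (b : \bar R) :=
  (a%:E < b)%E /\
  smooth_on_interval (fun d t => geodesic_at d t /\ null_at d t) (ico a b) c.

Definition future_inextendible c (a : R) (b : \bar R) :=
  ~ exists p, forall U, nbhs p U ->
      exists2 s, ico a b s & forall t, s < t -> ico a b t -> U (c t).

Definition inextendible_null_geodesic c (a : R) (b : \bar R) :=
  null_geodesic c a b /\ future_inextendible c a b.

Definition null_ray c (a : R) (b : \bar R) :=
  inextendible_null_geodesic c a b /\ achronal chron (c @` ico a b).

Definition future_endpoint c (a : R) (b : \bar R) (x : set M * set M) :=
  completion chron x /\
  forall t : nat -> R, {homo t : n k / (n < k)%N >-> n < k} ->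
    (forall n, ico a b (t n)) -> (t n)%:E @[n --> \oo] --> b ->
    chr_limit chron (fun n => point_pair chron (c (t n))) x.

(* Null geodesics are affinely parametrized by the geodesic equation, so      *)
(* future completeness on [a, b) means b = +oo.                               *)
Definition null_infinity : set (set M * set M) := [set x |
  [/\ cboundary chron x,
      exists c, [/\ null_ray c 0 +oo%E,
                    future_regular chron (c @` ico 0 +oo%E) &
                    future_endpoint c 0 +oo%E x] &
      forall c a b, inextendible_null_geodesic c a b ->
        future_endpoint c a b x -> b = +oo%E]].

Definition visible_from_infinity : set M := [set p |
  exists c a b x, [/\ inextendible_null_geodesic c a b, c a = p,
                      null_infinity x & future_endpoint c a b x]].

(* Meaningful only when null_infinity is not empty.                           *)
Definition black_hole : set M := ~` Jpast visible_from_infinity.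

End Causality.

Arguments chron {R} M.
Arguments causal {R} M.
Arguments null_infinity {R} M.
Arguments visible_from_infinity {R} M.
Arguments black_hole {R} M.

Section PlaneWave.
Variables (R : realType) (N : metric_space_data R) (H : N -> R -> R).
Local Notation m := (mdim N).

(* Coordinates are ordered (x, v, u); points of the spacetime are ((x, v), u). *)
Definition pw_coords (y : 'rV[R]_m) (v u : R) : 'rV[R]_(m + 2) :=
  row_mx y (row_mx v%:M u%:M : 'rV[R]_(1 + 1)).

Definition pw_x (y : 'rV[R]_(m + 2)) : 'rV[R]_m := lsubmx y.
Definition pw_v (y : 'rV[R]_(m + 2)) : R := rsubmx y 0 0.
Definition pw_u (y : 'rV[R]_(m + 2)) : R := rsubmx y 0 1.

Definition smooth_profile := forall i : idx N,
  smooth_on [set y : 'rV[R]_(m + 1) | cimage (atlas i) (lsubmx y)]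
            (fun y => H (cinv (atlas i) (lsubmx y)) (rsubmx y 0 0)).

Definition pw_chart (i : idx N) : chart R (N * R * R)%type (m + 2) :=
  Chart [set p : N * R * R | cdom (atlas i) p.1.1]
        (fun p => pw_coords (cmap (atlas i) p.1.1) p.1.2 p.2)
        (fun y => (cinv (atlas i) (pw_x y), pw_v y, pw_u y)).

(* g0 + 2 du dv + H du^2 *)
Definition pw_metric (i : idx N) (y : 'rV[R]_(m + 2)) : 'M[R]_(m + 2) :=
  block_mx (metric i (pw_x y)) 0 0
    (block_mx 0 1%:M 1%:M (H (cinv (atlas i) (pw_x y)) (pw_u y))%:M
       : 'M[R]_(1 + 1)).

(* - d/dv is future-directed *)
Definition plane_wave : spacetime_data R :=
  @SpacetimeData R (MetricData pw_chart pw_metric)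
    (fun _ _ => pw_coords 0 (-1) 0).

Definition pw_ray (x : N) (u : R) (s : R) : plane_wave := (x, - s, u).

End PlaneWave.

(* Main.v *)
Require Import Defs.
From mathcomp Require Import all_boot all_order all_algebra.
From mathcomp Require Import all_classical all_reals all_analysis.
From Stdlib Require Import Relation_Operators.
From mathcomp Require Import ring lra.
Import Order.TTheory GRing.Theory Num.Theory.
Import numFieldNormedType.Exports.

(* Along a causal curve du >= 0, and du > 0 if it is timelike.  Since
   g = g0 + 2 du dv + H du^2, lowering v along a timelike curve keeps it
   timelike, and a fast enough decrease of v compensates any other deformation.
   Hence P := I^-(gamma_{x,u}) is the same for every final part of the line and
   is invariant under translations in v; it is an IP, because any two of its
   points lie in the past of a common point (x, w, u') with u' < u.
   Take F with P ~_S F if there is one and F empty otherwise.  Future-regularity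
   makes (P, F) a future endpoint of the line, and P is not the past of a point,
   because no point has the same past as its translates in v.  Completeness of
   M makes all null geodesics complete, so (P, F) lies in J^+ and is reached
   along a null line from every point over (x, u): every point is visible. *)

Set Implicit Arguments.
Unset Strict Implicit.
Unset Printing Implicit Defensive.

Local Open Scope classical_set_scope.
Local Open Scope ring_scope.

(** * Higher derivatives of affine images of curves *)

Section Calculus.
Variable R : realType.

Lemma derivable_mulmxr (p q : nat) (f : R -> 'rV[R]_p) (A : 'M[R]_(p, q)) t :
  derivable f t 1 -> derivable (fun s => f s *m A) t 1.
Proof.
move/derivable_mxP => df; apply/derivable_mxP => i j.
rewrite (_ : (fun s => _) = \sum_k (fun s => A k j * f s i k)).
  by apply: derivable_sum => k; apply: derivableZ; exact: df.
by apply/funext => s; rewrite mxE fct_sumE; apply: eq_bigr => k _; rewrite mulrC.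
Qed.

Lemma derive1_mulmxr (p q : nat) (f : R -> 'rV[R]_p) (A : 'M[R]_(p, q)) t :
  derivable f t 1 -> derive1 (fun s => f s *m A) t = derive1 f t *m A.
Proof.
move=> df; rewrite !derive1E derive_mx; last exact: derivable_mulmxr.
rewrite (derive_mx df); apply/matrixP => i j; rewrite !mxE.
rewrite (_ : (fun s => _) = \sum_k (fun s => A k j * f s i k)); last first.
  by apply/funext => s; rewrite mxE fct_sumE; apply: eq_bigr => k _; rewrite mulrC.
move/derivable_mxP : df => df.
rewrite derive_sum; last by move=> k; apply: derivableZ; exact: df.
by apply: eq_bigr => k _; rewrite deriveZ ?mxE 1?mulrC.
Qed.

Lemma derive1_comp_coord (p : nat) (f : R -> 'rV[R]_p) t k :
  derivable f t 1 -> derive1 (fun s => f s 0 k) t = derive1 f t 0 k.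
Proof. by move=> df; rewrite !derive1E (derive_mx df) mxE. Qed.

Lemma derive1_near (V : normedModType R) (f g : R -> V) (t : R) :
  {near t, f =1 g} -> derive1 f t = derive1 g t.
Proof. by move=> fg; rewrite !derive1E; apply: near_eq_derive => //; exact: oner_neq0. Qed.

Lemma derivable_near (V : normedModType R) (f g : R -> V) (t : R) :
  {near t, f =1 g} -> derivable f t 1 -> derivable g t 1.
Proof. by move=> fg df; apply: near_eq_derivable df => //; exact: oner_neq0. Qed.

Lemma derive1n_shift (V : normedModType R) (f : R -> V) h k :
  derive1n k (fun s => f (s - h)) = fun s => derive1n k f (s - h).
Proof.
elim: k => // k IH; rewrite derive1nS IH; apply/funext => s.
rewrite derive1nS /derive1.
rewrite (_ : (fun e => _) =
  fun e => e^-1 *: (derive1n k f (e + (s - h)) - derive1n k f (s - h))) //.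
by apply/funext => e; rewrite addrA.
Qed.

Lemma derivable_shift (V : normedModType R) (f : R -> V) h t :
  derivable f (t - h) 1 -> derivable (fun s => f (s - h)) t 1.
Proof.
rewrite /derivable; suff -> : (fun e => e^-1 *: (f (e *: 1 + (t - h)) - f (t - h))) =
  (fun e => e^-1 *: (f (e *: 1 + t - h) - f (t - h))) by [].
by apply/funext => e; rewrite addrA.
Qed.

Lemma is_derive_line (V : normedModType R) (c w : V) (t : R) :
  is_derive t 1 (fun s : R => c + s *: w) w.
Proof.
suff cv : h^-1 *: ((c + (h *: 1 + t) *: w) - (c + t *: w)) @[h --> 0^'] --> w.
  by apply: DeriveDef; [apply/cvg_ex; exists w | exact/cvg_lim].
apply: cvg_near_cst; near=> h.
rewrite opprD addrACA subrr add0r -scalerBl addrK [h%:A]mulr1 scalerA.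
by rewrite mulVf ?scale1r//; near: h; exact: nbhs_dnbhs_neq.
Unshelve. all: by end_near. Qed.

Lemma derive1_line (V : normedModType R) (c w : V) :
  derive1 (fun s : R => c + s *: w) = cst w.
Proof.
apply/funext => t; have dl := is_derive_line c w t.
by rewrite derive1E derive_val.
Qed.

Lemma derivable_derive1n_line (V : normedModType R) (c w : V) k t :
  derivable (derive1n k (fun s : R => c + s *: w)) t 1.
Proof.
case: k => [|k]; first by have dl := is_derive_line c w t; exact: ex_derive.
rewrite derive1Sn derive1_line (_ : derive1n k _ = cst (if k is 0 then w else 0)).
  exact: derivable_cst.
elim: k => [//|k IH]; rewrite derive1nS IH.
by apply/funext => s; rewrite derive1_cst.
Qed.

Lemma derive1_affine (p q : nat) (f : R -> 'rV[R]_p) (A : 'M[R]_(p, q)) (C : 'rV[R]_q) t :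
  derivable f t 1 -> derive1 (fun s => f s *m A + C) t = derive1 f t *m A.
Proof.
move=> df; rewrite -(derive1_mulmxr A df) !derive1E.
rewrite (@deriveD _ _ _ (fun s => f s *m A) (cst C)) ?derive_cst ?addr0//.
exact: derivable_mulmxr.
Qed.

(** The hypothesis is required near [t], not only at [t], because a derivative of higher order
    depends on the lower ones in a neighbourhood. *)
Lemma derivable_derive1n_affine (p q : nat) (f : R -> 'rV[R]_p)
    (A : 'M[R]_(p, q)) (C : 'rV[R]_q) t k :
  (forall k, \forall s \near t, derivable (derive1n k f) s 1) ->
  derivable (derive1n k (fun s => f s *m A + C)) t 1.
Proof.
move=> df; case: k => [|k].
  apply: (@derivableD _ _ _ (fun s => f s *m A) (cst C)); last exact: derivable_cst.
  by apply: derivable_mulmxr; exact: (nbhs_singleton (df 0%N)).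
(* From order one on, the constant [C] has disappeared. *)
apply: (@derivable_near _ (fun s => derive1n k.+1 f s *m A)); last first.
  by apply: derivable_mulmxr; exact: (nbhs_singleton (df k.+1)).
elim: k => [|k IH].
  by apply: filterS (df 0%N) => s ds; rewrite [RHS](derive1_affine A C ds).
apply: filterS2 (near_join IH) (df k.+1) => s /derive1_near es ds.
by rewrite -[LHS](derive1_mulmxr A ds) -[LHS]/(derive1 _ s) es.
Qed.

End Calculus.

(** * Vectors and inner products in the coordinates (x, v, u) *)

Section Vectors.
Variables (R : realType) (N : metric_space_data R) (H : N -> R -> R).
Local Notation m := (mdim N).
Local Notation M := (plane_wave H).
Implicit Types (i : idx N) (y w : 'rV[R]_(m + 2)).

Lemma rV2E (w : 'rV[R]_2) : w = row_mx (w 0 0)%:M (w 0 1)%:M :> 'rV[R]_(1 + 1).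
Proof.
apply/rowP => k; rewrite mxE; case: splitP => j; rewrite ord1 => kE;
  by rewrite mxE eqxx mulr1n; congr (w _ _); apply/val_inj.
Qed.

Lemma pw_coordsK w : pw_coords (pw_x w) (pw_v w) (pw_u w) = w.
Proof. by rewrite /pw_coords /pw_v /pw_u -rV2E hsubmxK. Qed.

Lemma pw_x_coords (z : 'rV[R]_m) v u : pw_x (pw_coords z v u) = z.
Proof. by rewrite /pw_x row_mxKl. Qed.

Lemma pw_v_coords (z : 'rV[R]_m) v u : pw_v (pw_coords z v u) = v.
Proof.
rewrite /pw_v row_mxKr.
have -> : 0 = lshift 1 0 :> 'I_(1 + 1) by exact: val_inj.
by rewrite [LHS](@row_mxEl _ 1 1 1) mxE eqxx mulr1n.
Qed.

Lemma pw_u_coords (z : 'rV[R]_m) v u : pw_u (pw_coords z v u) = u.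
Proof.
rewrite /pw_u row_mxKr.
have -> : 1 = rshift 1 0 :> 'I_(1 + 1) by exact: val_inj.
by rewrite [LHS](@row_mxEr _ 1 1 1) mxE eqxx mulr1n.
Qed.

Definition pw_coordsE := (pw_x_coords, pw_v_coords, pw_u_coords).

Lemma pw_xZ r w : pw_x (r *: w) = r *: pw_x w.
Proof. exact: linearZ. Qed.

Lemma pw_uZ r w : pw_u (r *: w) = r * pw_u w.
Proof. by rewrite /pw_u !mxE. Qed.

Lemma pw_vZ r w : pw_v (r *: w) = r * pw_v w.
Proof. by rewrite /pw_v !mxE. Qed.

Lemma pw_coords_line (x z : 'rV[R]_m) v u a b (t : R) :
  pw_coords x v u + t *: pw_coords z a b =
  pw_coords (x + t *: z) (v + t * a) (u + t * b).
Proof.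
rewrite -[LHS]pw_coordsK; congr pw_coords.
- by rewrite /pw_x linearD /= -/(pw_x _) -/(pw_x _) pw_xZ !pw_x_coords.
- have -> w w' : pw_v (w + w') = pw_v w + pw_v w' by rewrite /pw_v !mxE.
  by rewrite pw_vZ !pw_v_coords.
- have -> w w' : pw_u (w + w') = pw_u w + pw_u w' by rewrite /pw_u !mxE.
  by rewrite pw_uZ !pw_u_coords.
Qed.

Lemma inner_block n (G : 'M[R]_n) (h : R) (x x' : 'rV[R]_n) (v u v' u' : R) :
  (row_mx x (row_mx v%:M u%:M : 'rV[R]_(1 + 1)) *m
   block_mx G 0 0 (block_mx 0 1%:M 1%:M h%:M : 'M[R]_(1 + 1)) *m
   (row_mx x' (row_mx v'%:M u'%:M : 'rV[R]_(1 + 1)))^T) 0 0 =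
  (x *m G *m x'^T) 0 0 + v * u' + u * v' + h * u * u'.
Proof.
rewrite mul_row_block !mulmx0 addr0 add0r.
rewrite tr_row_mx mul_row_col mul_row_block !mulmx0 add0r !mulmx1 tr_row_mx.
rewrite mul_row_col !tr_scalar_mx -!scalar_mxM -raddfD /= -scalar_mxM -raddfD /=.
rewrite mxE -!addrA; congr (_ + _).
by rewrite mxE eqxx mulr1n; ring.
Qed.

Lemma inner_pw i y w w' : @inner R M i y w w' =
  (pw_x w *m metric i (pw_x y) *m (pw_x w')^T) 0 0 + pw_v w * pw_u w' +
  pw_u w * pw_v w' + H (cinv (atlas i) (pw_x y)) (pw_u y) * pw_u w * pw_u w'.
Proof.
rewrite -[in LHS](pw_coordsK w) -[in LHS](pw_coordsK w').
exact: inner_block.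
Qed.

(** The product of [w] with the orientation field - d/dv is [- pw_u w]. The alternative that [w] is
    a multiple of this field is excluded, since the field is null. *)
Lemma future_vector_pw i y w : @inner R M i y w w < 0 ->
  @future_vector R M i y w <-> 0 < pw_u w.
Proof.
move=> w0; rewrite /future_vector inner_pw !pw_coordsE.
rewrite mxE big1 => [|k _]; last by rewrite !mxE mulr0.
rewrite !mulr0 !addr0 add0r mulrN1 oppr_lt0; split; last by left.
case=> // -[r r0 wE]; move: w0; rewrite wE /= inner_pw.
rewrite pw_uZ pw_xZ !pw_coordsE scaler0.
rewrite mxE big1 => [|k _]; last by rewrite !mxE mulr0.
by rewrite !(mulr0, mul0r, addr0) ltxx.
Qed.

End Vectors.

(** * Continuity of charts and of the profile *)

Lemma cvg_mx (R : realType) (T : Type) (F : set_system T) (p q : nat)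
    (f : T -> 'M[R]_(p, q)) (l : 'M[R]_(p, q)) : Filter F ->
  (forall i j, f x i j @[x --> F] --> l i j) -> f x @[x --> F] --> l.
Proof.
move=> FF fl; apply/cvg_ballP => e e0.
have : \forall x \near F, forall ij, ball (l ij.1 ij.2) e (f x ij.1 ij.2).
  by apply: filter_forall => -[i j]; exact: (cvg_ball (fl i j) e0).
by apply: filterS => x fx; split=> // i j; exact: (fx (i, j)).
Qed.

Section Curves.
Variables (R : realType) (N : metric_space_data R) (H : N -> R -> R).
Local Notation m := (mdim N).
Local Notation M := (plane_wave H).
Implicit Types (i : idx N) (y w : 'rV[R]_(m + 2)) (d : R -> M).
Hypothesis hA : smooth_atlas N.
Hypothesis hH : smooth_profile H.

Lemma chartE (x : N) : exists i, cdom (atlas i) x.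
Proof. by case: hA. Qed.

Lemma cinvK i (x : N) : cdom (atlas i) x -> cinv (atlas i) (cmap (atlas i) x) = x.
Proof. by case: hA => _ _ + _ _; apply. Qed.

Lemma cmap_continuous i (x : N) : cdom (atlas i) x ->
  {for x, continuous (cmap (atlas i))}.
Proof.
case: hA => _ /(_ i)[oi _] _ /(_ i)[ci _] _ ix.
by rewrite continuous_open_subspace// in ci; apply: ci; rewrite inE.
Qed.

Lemma nbhs_cdom i (x : N) : cdom (atlas i) x -> nbhs x (cdom (atlas i)).
Proof. by case: hA => _ /(_ i)[oi _] _ _ _ ix; exact: open_nbhs_nbhs. Qed.

Lemma profile_continuous : continuous (fun p : N * R => H p.1 p.2).
Proof.
move=> p; have [i ip] := chartE p.1.
pose g (p : N * R) : 'rV[R]_(m + 1) := row_mx (cmap (atlas i) p.1) p.2%:M.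
have gc : g q @[q --> p] --> g p.
  apply: cvg_mx => a b; rewrite /g.
  rewrite (_ : (fun q => _) = fun q : N * R =>
    match fintype.split b with inl k => cmap (atlas i) q.1 a k | inr _ => q.2 end).
    rewrite mxE; case: fintype.splitP => k _; last by rewrite !ord1 mxE eqxx; exact: cvg_snd.
    have c1 : cmap (atlas i) q.1 @[q --> p] --> cmap (atlas i) p.1.
      apply: (cvg_comp (fun q : N * R => q.1) (cmap (atlas i)) _ (cmap_continuous ip)).
      exact: cvg_fst.
    exact: (cvg_comp _ _ c1 (@coord_continuous _ _ _ a k _)).
  apply/funext => q; rewrite mxE; case: fintype.splitP => // k _.
  by rewrite !ord1 mxE eqxx.
have rE (q : N * R) : rsubmx (g q) 0 0 = q.2 by rewrite /g row_mxKr mxE eqxx mulr1n.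
(* The empty list of directions gives continuity of the coordinate expression of [H] itself. *)
have [|hc _] := @hH i [::] (g p); first by rewrite /= /g row_mxKl; exists p.1.
have := cvg_comp g _ gc hc.
rewrite /= rE {2}/g row_mxKl cinvK// => hp.
apply: cvg_trans hp; apply: near_eq_cvg.
have : \forall q \near p, cdom (atlas i) q.1.
  by apply: (cvg_fst (F := nbhs p.1) (G := nbhs p.2)); exact: nbhs_cdom.
by apply: filterS => q iq; rewrite /= rE {1}/g row_mxKl cinvK.
Qed.

End Curves.

(** * Affine images of timelike curves *)

Section Pieces.
Variables (R : realType) (N : metric_space_data R) (H : N -> R -> R).
Local Notation m := (mdim N).
Local Notation M := (plane_wave H).
Implicit Types (i : idx N) (y w : 'rV[R]_(m + 2)) (d : R -> M).
Hypothesis hA : smooth_atlas N.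
Hypothesis hH : smooth_profile H.

(** Two cases are used: [al = la = 1], which changes [v] by an affine function of [u], and
    [al = la^-1], which also rescales [u]. *)
Definition affine_map (al ka ga la mu : R) (p : M) : M :=
  (p.1.1, al * p.1.2 + ka * p.2 + ga, la * p.2 + mu).

Definition affine_mx (al ka la : R) : 'M[R]_(m + 2) :=
  block_mx 1%:M 0 0 (block_mx al%:M 0 ka%:M la%:M : 'M[R]_(1 + 1)).

Lemma pw_coords_affine (x : 'rV[R]_m) v u al ka ga la mu :
  pw_coords x (al * v + ka * u + ga) (la * u + mu) =
  pw_coords x v u *m affine_mx al ka la + pw_coords 0 ga mu.
Proof.
rewrite /pw_coords /affine_mx (@mul_row_block _ 1 m 2 m 2) !mulmx0 addr0 add0r mulmx1.
rewrite [X in row_mx _ X + _](@mul_row_block _ 1 1 1 1 1) mulmx0 add0r -!scalar_mxM.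
rewrite -raddfD /= [LHS]/(row_mx _ _) (@add_row_mx _ 1 m 2) addr0.
rewrite [X in row_mx _ X](@add_row_mx _ 1 1 1) -!raddfD /=.
by rewrite [v * _]mulrC [u * ka]mulrC [u * la]mulrC.
Qed.

Lemma coord_curve_affine i d al ka ga la mu :
  @coord_curve R M i (affine_map al ka ga la mu \o d) =
  fun t => @coord_curve R M i d t *m affine_mx al ka la + pw_coords 0 ga mu.
Proof. by apply/funext => t; exact: pw_coords_affine. Qed.

Lemma affine_mxE w al ka la : w *m affine_mx al ka la =
  pw_coords (pw_x w) (al * pw_v w + ka * pw_u w) (la * pw_u w).
Proof.
have := pw_coords_affine (pw_x w) (pw_v w) (pw_u w) al ka 0 la 0.
rewrite !addr0 pw_coordsK => ->; rewrite (_ : pw_coords 0 0 0 = 0) ?addr0//.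
by rewrite /pw_coords !raddf0 !row_mx0.
Qed.

Lemma cvg_pw_x (p : M) : q.1.1 @[q --> p] --> p.1.1.
Proof.
have c1 : q.1 @[q --> p] --> p.1 by exact: cvg_fst.
have c2 : r.1 @[r --> p.1] --> p.1.1 by exact: cvg_fst.
exact: cvg_comp c1 c2.
Qed.

Lemma cvg_pw_v (p : M) : q.1.2 @[q --> p] --> p.1.2.
Proof.
have c1 : q.1 @[q --> p] --> p.1 by exact: cvg_fst.
have c2 : r.2 @[r --> p.1] --> p.1.2 by exact: cvg_snd.
exact: cvg_comp c1 c2.
Qed.

Lemma affine_map_continuous al ka ga la mu :
  continuous (affine_map al ka ga la mu).
Proof.
move=> p; have cu : q.2 @[q --> p] --> p.2 by exact: cvg_snd.
have cv : al * q.1.2 + ka * q.2 + ga @[q --> p] --> al * p.1.2 + ka * p.2 + ga.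
  apply: cvgD; last exact: cvg_cst.
  apply: cvgD; (apply: cvgM; first exact: cvg_cst); last exact: cu.
  exact: cvg_pw_v.
have cu' : la * q.2 + mu @[q --> p] --> la * p.2 + mu.
  by apply: cvgD; [apply: cvgM; [exact: cvg_cst | exact: cu] | exact: cvg_cst].
exact: (cvg_pair (cvg_pair (@cvg_pw_x p) cv) cu').
Qed.

Lemma nbhs_pw_cdom i (p : M) : cdom (atlas i) p.1.1 ->
  \forall q \near p, cdom (atlas i) q.1.1.
Proof.
move=> ip; exact: (cvg_pw_x (nbhs_cdom hA ip)).
Qed.

Lemma near_derivable_derive1n (U : set R) d t i : open U -> @smooth_curve R M U d ->
  U t -> cdom (atlas i) (d t).1.1 -> forall k, \forall s \near t,
  derivable (derive1n k (@coord_curve R M i d)) s 1.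
Proof.
move=> oU sd Ut it k; have [dc _] := sd _ Ut.
have := dc _ (nbhs_pw_cdom it); have : nbhs t U by exact: open_nbhs_nbhs.
by apply: filterS2 => s Us /= is_; have [_] := sd _ Us; apply.
Qed.

Lemma smooth_affine (U : set R) d al ka ga la mu : open U ->
  @smooth_curve R M U d -> @smooth_curve R M U (affine_map al ka ga la mu \o d).
Proof.
move=> oU sd t Ut; split.
  have [dc _] := sd _ Ut.
  exact: (cvg_comp _ _ dc (@affine_map_continuous _ _ _ _ _ (d t))).
move=> i k it; rewrite coord_curve_affine.
apply: derivable_derive1n_affine; exact: near_derivable_derive1n sd Ut it.
Qed.

(* Since al * la = 1, the terms in du dv cancel in the difference of the two
   norms, which is therefore a multiple of du ^ 2. *)
Lemma timelike_affine (U : set R) d t al ka ga la mu :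
  @smooth_curve R M U d -> U t -> @timelike_at R M d t ->
  al * la = 1 -> 0 < la ->
  2 * ka * la + H (d t).1.1 (la * (d t).2 + mu) * la ^+ 2 <= H (d t).1.1 (d t).2 ->
  @timelike_at R M (affine_map al ka ga la mu \o d) t.
Proof.
move=> sd Ut td al1 la0 hle i it.
have [_ /(_ i 0%N it) /= dd] := sd _ Ut.
have /= [w0 /(future_vector_pw w0) wu] := td i it.
have wt : derive1 (coord_curve i (affine_map al ka ga la mu \o d)) t =
    derive1 (@coord_curve R M i d) t *m affine_mx al ka la.
  by rewrite coord_curve_affine derive1_affine.
suff w1 : inner i (coord_curve i (affine_map al ka ga la mu \o d) t)
    (derive1 (coord_curve i (affine_map al ka ga la mu \o d)) t)
    (derive1 (coord_curve i (affine_map al ka ga la mu \o d)) t) < 0.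
  split=> //; apply/(future_vector_pw w1); rewrite wt affine_mxE pw_u_coords.
  exact: mulr_gt0.
move: w0 wu; rewrite wt affine_mxE.
set w := derive1 _ t; rewrite !inner_pw !pw_coordsE.
rewrite /affine_map /= (cinvK hA)//.
set v := pw_v w; set u := pw_u w; set g := (_ 0 0).
set h := H _ (d t).2; set h' := H _ _; rewrite -/h -/h' in hle => w0 u0.
suff : (2 * ka * la + h' * la ^+ 2 - h) * u ^+ 2 <= 0.
  move=> hu; apply: le_lt_trans w0; rewrite -subr_le0; apply: le_trans hu.
  rewrite le_eqVlt; apply/orP; left; rewrite -subr_eq0; apply/eqP.
  transitivity (2 * v * u * (al * la - 1)); first by ring.
  by rewrite al1 subrr mulr0.
by rewrite mulr_le0_ge0 ?sqr_ge0// subr_le0.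
Qed.

End Pieces.

(** * Gluing and cutting timelike curves *)

Section Gluing.
Variables (R : realType) (M : spacetime_data R).
Implicit Types (c d : R -> M) (p q r : M).

Definition timelike_segment c (a b : R) :=
  a < b /\ smooth_on_interval (@timelike_at R M) `[a, b] c.

(** Its transitive closure is [chron], so properties of [chron] are proved for one smooth piece and
    extended by induction. *)
Definition timelike_piece p q :=
  exists c a b, [/\ timelike_segment c a b, c a = p & c b = q].

Lemma smooth_on_interval_eq (Q : (R -> M) -> R -> Prop) (I J : set R) c d :
  I `<=` J -> (forall t, I t -> c t = d t) ->
  smooth_on_interval Q J c -> smooth_on_interval Q I d.
Proof.
move=> IJ cd [U [e [oU JU se ce Qe]]]; exists U, e; split=> //.
- exact: subset_trans JU.
- by move=> t It; rewrite -cd// ce//; exact: IJ.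
- by move=> t /IJ; exact: Qe.
Qed.

Lemma coord_curve_shift i c h : coord_curve i (fun t => c (t - h)) =
  fun t => coord_curve i c (t - h).
Proof. by []. Qed.

Lemma timelike_segment_shift c a b h : timelike_segment c a b ->
  timelike_segment (fun t => c (t - h)) (a + h) (b + h).
Proof.
move=> [ab [U [d [oU abU sd cd td]]]].
have hc t : {for t, continuous (fun t => t - h)}.
  by apply: cvgB; [exact: cvg_id | exact: cvg_cst].
have abh t : t \in `[a + h, b + h] -> t - h \in `[a, b].
  by rewrite !in_itv /= lerBrDr lerBlDr.
split; first by rewrite ltrD2r.
exists [set t | U (t - h)], (fun t => d (t - h)); split.
- by apply: open_comp => // t _; exact: hc.
- by move=> t /abh /abU.
- move=> t /sd[dc dd]; split; first exact: (cvg_comp _ _ (hc t) dc).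
  move=> i k it; rewrite coord_curve_shift derive1n_shift.
  by apply: derivable_shift; exact: dd.
- by move=> t /abh /cd.
- move=> t /abh /td tdt i it.
  by rewrite coord_curve_shift -[derive1 _]/(derive1n 1 _) derive1n_shift; exact: tdt.
Qed.

Lemma timelike_curve_lt c a b : timelike_curve c a b -> a < b.
Proof. by elim=> [s t []|s t u _ st _ tu]//; exact: lt_trans tu. Qed.

Lemma timelike_curve_eq c d a b : (forall t, a <= t <= b -> c t = d t) ->
  timelike_curve c a b -> timelike_curve d a b.
Proof.
move=> + cab; elim: cab d => {a b} [s t [st cst] d cd|s t u st IHst tu IHtu d cd].
  apply: t_step; split=> //; apply: (smooth_on_interval_eq _ _ cst) => //.
have /ltW slt := timelike_curve_lt st; have /ltW tlu := timelike_curve_lt tu.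
apply: t_trans (IHst _ _) (IHtu _ _) => x /andP[x1 x2]; apply: cd.
  by rewrite x1 (le_trans x2).
by rewrite x2 (le_trans slt).
Qed.

Lemma timelike_curve_shift c a b h : timelike_curve c a b ->
  timelike_curve (fun t => c (t - h)) (a + h) (b + h).
Proof.
elim=> [s t st|s t u _ IHs _ IHt]; last exact: t_trans IHs IHt.
by apply: t_step; exact: timelike_segment_shift.
Qed.

(** The second curve is delayed by [b - a'] so that it starts at time [b]. The junction [e b] is
    recorded because the strong causality argument needs a curve through a prescribed point. *)
Lemma timelike_curve_glue c d a b a' b' :
  timelike_curve c a b -> timelike_curve d a' b' -> c b = d a' ->
  exists e b'', [/\ timelike_curve e a b'', a < b < b'', e a = c a, e b = c b &
                    e b'' = d b'].
Proof.
move=> cab dab cd; pose h := b - a'.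
have alb := timelike_curve_lt cab; have alb' := timelike_curve_lt dab.
pose e t := if t <= b then c t else d (t - h).
have eb : b < b' + h by rewrite /h; lra.
exists e, (b' + h); split; rewrite ?alb ?eb//.
- apply: t_trans (timelike_curve_eq _ cab) (_ : timelike_curve e b (b' + h)).
    by move=> t /andP[_ tb]; rewrite /e tb.
  have := timelike_curve_shift h dab.
  rewrite (_ : a' + h = b); last by rewrite /h; ring.
  apply: timelike_curve_eq => t /andP[bt _]; rewrite /e; case: ifPn => // tb.
  have -> : t = b by apply/le_anti/andP.
  by rewrite cd /h; congr d; ring.
- by rewrite /e (ltW alb).
- by rewrite /e lexx.
- by rewrite /e leNgt eb /=; congr d; ring.
Qed.

Lemma chron_trans p q r : chron M p q -> chron M q r -> chron M p r.
Proof.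
move=> [c [a [b [cab <- cb]]]] [d [a' [b' [dab da <-]]]].
have [|e [b'' [e1 _ ea _ eb]]] := timelike_curve_glue cab dab; first by rewrite cb.
by exists e, a, b''.
Qed.

Lemma chron_piece p q : timelike_piece p q -> chron M p q.
Proof. by move=> [c [a [b [cab <- <-]]]]; exists c, a, b; split=> //; exact: t_step. Qed.

Lemma pieces_of_chron p q : chron M p q -> clos_trans M timelike_piece p q.
Proof.
move=> [c [a [b [cab <- <-]]]]; elim: cab => [s t st|s t u _ IHs _ IHt].
  by apply: t_step; exists c, s, t.
exact: t_trans IHs IHt.
Qed.

(** Trades the curve for its smooth extension to a neighbourhood of the interval, so that no
    one-sided derivative remains. *)
Lemma timelike_pieceP p q : timelike_piece p q ->
  exists (U : set R) c a b, [/\ open U, `[a, b] `<=` U, smooth_curve U c,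
    (forall t, a <= t <= b -> timelike_at c t) & [/\ a < b, c a = p & c b = q]].
Proof.
move=> [c [a [b [[ab [U [d [oU abU sd cd td]]]] ca cb]]]].
exists U, d, a, b; split=> //; split=> //.
- by rewrite -cd// /= in_itv /= lexx ltW.
- by rewrite -cd// /= in_itv /= lexx ltW.
Qed.

Lemma timelike_piece_of_curve (U : set R) c a b : open U -> `[a, b] `<=` U ->
  smooth_curve U c -> (forall t, a <= t <= b -> timelike_at c t) -> a < b ->
  timelike_piece (c a) (c b).
Proof.
move=> oU abU sc tc ab; exists c, a, b; split=> //; split=> //.
by exists U, c; split.
Qed.

Lemma timelike_piece_cut p q (W : set M) : timelike_piece p q -> nbhs q W ->
  exists r, [/\ W r, timelike_piece p r & timelike_piece r q].
Proof.
move=> /timelike_pieceP[U [c [a [b [oU abU sc tc [ab <- <-]]]]]] Wb.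
have Ub : U b by apply: abU; rewrite /= in_itv /= lexx ltW.
have [cb _] := sc _ Ub.
have [e /= e0 eW] := (nbhs_ballP _ _).1 (cb _ Wb).
(* The midpoint keeps [s] above [a], and [b - e / 2] keeps [c s] in [W]. *)
pose s := Num.max ((a + b) / 2) (b - e / 2).
have as_ : a < s by rewrite /s lt_max; apply/orP; left; lra.
have sb : s < b by rewrite /s gt_max; apply/andP; split; lra.
exists (c s); split.
- apply: eW; rewrite /ball /= ger0_norm ?subr_ge0 ?ltW//.
  have : b - e / 2 <= s by rewrite /s le_max lexx orbT.
  by lra.
- apply: (timelike_piece_of_curve oU) => //.
    move=> t /=; rewrite in_itv/= => /andP[t1 t2]; apply: abU.
    by rewrite /= in_itv/= t1/= (le_trans t2)// ltW.
  by move=> t /andP[t1 t2]; apply: tc; rewrite t1/= (le_trans t2)// ltW.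
- apply: (timelike_piece_of_curve oU) => //.
    move=> t /=; rewrite in_itv/= => /andP[t1 t2]; apply: abU.
    by rewrite /= in_itv/= t2 andbT (le_trans _ t1)// ltW.
  by move=> t /andP[t1 t2]; apply: tc; rewrite t2 andbT (le_trans _ t1)// ltW.
Qed.

(** Only the last smooth piece has to be cut. With [W] the whole space this is the interpolation
    property of [chron]. *)
Lemma chron_dense p q (W : set M) : chron M p q -> nbhs q W ->
  exists r, [/\ W r, chron M p r & chron M r q].
Proof.
move=> /pieces_of_chron; elim=> {p q} [p q pq Wq|p q r pq _ qr IH /IH].
  have [r [Wr pr rq]] := timelike_piece_cut pq Wq.
  by exists r; split=> //; exact: chron_piece.
move=> [s [Ws qs sr]]; exists s; split=> //; apply: chron_trans qs.
elim: pq => {p q qr IH r Ws sr s} [? ? /chron_piece//|p q r _ pq _ qr].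
exact: chron_trans qr.
Qed.

End Gluing.

(** * Chronology of a plane wave *)

Section PlaneWaveChronology.
Variables (R : realType) (N : metric_space_data R) (H : N -> R -> R).
Local Notation m := (mdim N).
Local Notation M := (plane_wave H).
Hypothesis hA : smooth_atlas N.
Hypothesis hH : smooth_profile H.

Lemma within_continuous_segment (f : R -> R) a b :
  (forall t, a <= t <= b -> {for t, continuous f}) ->
  {within `[a, b], continuous f}.
Proof.
move=> fc; apply: continuous_in_subspaceT => t; rewrite inE/= in_itv/=; exact: fc.
Qed.

(** By [future_vector_pw] the velocity has positive u-component. *)
Lemma timelike_piece_u (p q : M) : timelike_piece p q -> p.2 < q.2.
Proof.
move=> /timelike_pieceP[U [c [a [b [oU abU sc tc [ab <- <-]]]]]].
have Ut t : a <= t <= b -> U t by move=> tab; apply: abU; rewrite /= in_itv.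
have du t : a <= t <= b ->
    derivable (fun s => (c s).2) t 1 /\ 0 < derive1 (fun s => (c s).2) t.
  move=> tab; have [i it] := chartE hA (c t).1.1.
  have [_ /(_ i 0%N it) /= dc] := sc _ (Ut _ tab).
  have uE : (fun s => (c s).2) = fun s => @coord_curve R M i c s 0 (rshift m 1).
    apply/funext => s; have := pw_u_coords (cmap (atlas i) (c s).1.1) (c s).1.2 (c s).2.
    by rewrite /pw_u mxE.
  rewrite uE (derive1_comp_coord _ dc); split; first exact: (derivable_mxP _ _ _).1.
  have [w0 /(future_vector_pw w0)] := tc _ tab i it.
  by rewrite /pw_u mxE.
apply: (@gtr0_derive1_lt_cc _ (fun s => (c s).2) a b) => //.
- by move=> t; rewrite in_itv/= => /andP[/ltW t1 /ltW t2]; apply: (du t _).1; rewrite t1.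
- by move=> t; rewrite in_itv/= => /andP[/ltW t1 /ltW t2]; apply: (du t _).2; rewrite t1.
- apply: within_continuous_segment => t /du[+ _].
  by move=> /derivable1_diffP /differentiable_continuous.
- by rewrite in_itv/= lexx ltW.
- by rewrite in_itv/= lexx ltW.
Qed.

Lemma chron_u (p q : M) : chron M p q -> p.2 < q.2.
Proof.
move=> /pieces_of_chron; elim=> [? ? /timelike_piece_u//|? ? ? _ + _].
exact: lt_trans.
Qed.

(** Since - d/dv is future-directed, a negative [a] moves towards the future. *)
Definition vshift (a : R) (p : M) : M := (p.1.1, p.1.2 + a, p.2).

Lemma timelike_piece_vshift a a' (p q : M) : a' <= a ->
  timelike_piece p q -> timelike_piece (vshift a p) (vshift a' q).
Proof.
move=> aa' pq; have uu := timelike_piece_u pq.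
move: pq uu => /timelike_pieceP[U [c [s [t [oU stU sc tc [st <- <-]]]]]] uu.
(* Slope of the affine function of [u] that is [a] at the start and [a'] at the end of the piece. It
   is at most 0, which is all that [timelike_affine] asks for when [al = la = 1] and [mu = 0]. *)
pose ka := (a' - a) / ((c t).2 - (c s).2).
pose f := affine_map (H := H) 1 ka (a - ka * (c s).2) 1 0.
have ka0 : ka <= 0 by rewrite mulr_le0_ge0 ?invr_ge0; lra.
have <- : f (c s) = vshift a (c s).
  by rewrite /f /affine_map /vshift; congr (_, _, _); ring.
have <- : f (c t) = vshift a' (c t).
  rewrite /f /affine_map /vshift; congr (_, _, _); last by ring.
  by rewrite /ka; field; lra.
apply: (@timelike_piece_of_curve _ M U (f \o c) s t oU stU _ _ st).
  exact: (smooth_affine hA _ _ _ _ _ oU sc).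
move=> x xst; have Ux : U x by apply: stU; rewrite /= in_itv.
apply: (@timelike_affine _ _ _ hA U c x 1 ka _ 1 0 sc Ux (tc x xst)); rewrite ?mulr1//.
by rewrite mul1r addr0 expr1n mulr1; lra.
Qed.

Lemma chron_vshift a a' (p q : M) : a' <= a ->
  chron M p q -> chron M (vshift a p) (vshift a' q).
Proof.
move=> + /pieces_of_chron pq; elim: pq a a' => {p q} [p q pq|p r q _ IH1 _ IH2] a a' aa'.
  by apply: chron_piece; exact: timelike_piece_vshift.
exact: chron_trans (IH1 a a (lexx a)) (IH2 _ _ aa').
Qed.

Lemma profile_curve_continuous (c : R -> M) la mu t : {for t, continuous c} ->
  {for t, continuous (fun s => H (c s).1.1 (la * (c s).2 + mu))}.
Proof.
move=> cc; have cx : (c s).1.1 @[s --> t] --> (c t).1.1.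
  exact: (cvg_comp c (fun q : M => q.1.1) cc (@cvg_pw_x _ _ H (c t))).
have cu : (c s).2 @[s --> t] --> (c t).2.
  exact: (cvg_comp c (fun q : M => q.2) cc cvg_snd).
have cl : la * (c s).2 + mu @[s --> t] --> la * (c t).2 + mu.
  by apply: cvgD; [apply: cvgM; [exact: cvg_cst | exact: cu] | exact: cvg_cst].
have cp : ((c s).1.1, la * (c s).2 + mu) @[s --> t] --> ((c t).1.1, la * (c t).2 + mu).
  exact: (cvg_pair cx cl).
have hp := @profile_continuous _ _ _ hA hH ((c t).1.1, la * (c t).2 + mu).
exact: (cvg_comp _ _ cp hp).
Qed.

(* The u-coordinate is contracted by the factor la towards its initial value,
   and v is lowered at a rate ka bounding the resulting change of H. *)
Lemma timelike_piece_squeeze (p q : M) u : timelike_piece p q -> p.2 < u < q.2 ->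
  exists w, timelike_piece p (q.1.1, w, u).
Proof.
move=> /timelike_pieceP[U [c [s [t [oU stU sc tc [st <- <-]]]]]] /andP[su ut].
have Ux x : s <= x <= t -> U x by move=> xst; apply: stU; rewrite /= in_itv.
pose la := (u - (c s).2) / ((c t).2 - (c s).2).
have la0 : 0 < la by rewrite divr_gt0; lra.
pose mu := (c s).2 - la * (c s).2.
(* The change in the coefficient of du^2. The second term is written with [1 * _ + 0] to fit
   [profile_curve_continuous]. *)
pose h x := H (c x).1.1 (la * (c x).2 + mu) * la ^+ 2 - H (c x).1.1 (1 * (c x).2 + 0).
have [] := @EVT_max _ h s t (ltW st).
  apply: within_continuous_segment => x /Ux /sc[cc _].
  apply: cvgB; last exact: profile_curve_continuous.
  by apply: cvgM; [exact: profile_curve_continuous | exact: cvg_cst].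
(* Now [2 * ka * la = - h x0], so the inequality asked for by [timelike_affine] becomes
   [h x <= h x0]. The constant [ga] below keeps the starting point fixed. *)
move=> x0 _ hmax; pose ka := - h x0 / (2 * la).
pose ga := (c s).1.2 - la^-1 * (c s).1.2 - ka * (c s).2.
pose f := affine_map (H := H) la^-1 ka ga la mu.
exists (f (c t)).1.2.
have -> : c s = f (c s).
  rewrite /f /affine_map /ga /mu; case: (c s) => -[x v] v' /=.
  by congr (_, _, _); ring.
have -> : ((c t).1.1, (f (c t)).1.2, u) = f (c t).
  rewrite /f /affine_map; congr (_, _, _).
  by rewrite /mu /la; field; lra.
apply: (@timelike_piece_of_curve _ M U (f \o c) s t oU stU _ _ st).
  exact: (smooth_affine hA _ _ _ _ _ oU sc).
move=> x xst;
apply: (@timelike_affine _ _ _ hA U c x _ ka _ la mu sc (Ux x xst) (tc x xst)) => //.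
  by rewrite mulVf ?gt_eqF.
have -> : 2 * ka * la = - h x0 by rewrite /ka; field; lra.
have := hmax x; rewrite in_itv/= => /(_ xst).
by rewrite /h mul1r addr0; lra.
Qed.

(** Only the last smooth piece is squeezed; [u0] is the value of [u] where it starts. *)
Lemma chron_squeeze (p q : M) : chron M p q ->
  exists2 u0, u0 < q.2 & forall u, u0 < u < q.2 -> exists w, chron M p (q.1.1, w, u).
Proof.
move=> /pieces_of_chron; elim=> {p q} [p q pq|p r q pr _ _ [u0 u0q IH]].
  exists p.2; first exact: timelike_piece_u.
  by move=> u /(timelike_piece_squeeze pq)[w /chron_piece pw]; exists w.
exists u0 => // u /IH[w rw]; exists w; apply: chron_trans rw.
elim: pr => {p r q u0 u0q IH u w} [? ? /chron_piece//|? ? ? _ + _].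
exact: chron_trans.
Qed.

Lemma timelike_piece_vertical (x : N) v u u' : u < u' ->
  exists w, timelike_piece ((x, v, u) : M) (x, w, u').
Proof.
move=> uu'; have [] := @EVT_max _ (H x) u u' (ltW uu').
  apply: within_continuous_segment => t _.
  have cu : (x, s) @[s --> t] --> (x, t).
    exact: (cvg_pair (cvg_cst x (F := nbhs t)) (@cvg_id _ (nbhs t))).
  exact: (cvg_comp _ _ cu (@profile_continuous _ _ _ hA hH (x, t))).
(* With [x] fixed, dv = [K] and du = 1, the norm of the velocity is [2 * K + H], which is negative
   because [H x t0] bounds [H] on the segment. *)
move=> t0 _ hmax; pose K : R := - (`|H x t0| + 1).
pose c (t : R) : M := (x, v + t * K, u + t * 1).
exists (v + (u' - u) * K).
have -> : (x, v, u) = c 0 by rewrite /c !mul0r !addr0.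
have -> : (x, v + (u' - u) * K, u') = c (u' - u) by rewrite /c; congr (_, _, _); ring.
have cE (i : idx N) : @coord_curve R M i c =
    fun t : R => pw_coords (cmap (atlas i) x) v u + t *: pw_coords 0 K 1.
  by apply/funext => t; rewrite pw_coords_line scaler0 addr0.
apply: (@timelike_piece_of_curve _ M setT c) => //; first exact: openT.
- move=> t _; split; last by move=> i k _; rewrite cE; exact: derivable_derive1n_line.
  have cl (a b : R) : a + s * b @[s --> t] --> a + t * b.
    by apply: cvgD; [exact: cvg_cst | apply: cvgM; [exact: cvg_id | exact: cvg_cst]].
  exact: (cvg_pair (cvg_pair (cvg_cst x) (cl v K)) (cl u 1)).
- move=> t /andP[t0' tu] i it.
  have -> : derive1 (@coord_curve R M i c) t = pw_coords 0 K 1.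
    by rewrite cE derive1_line.
  have w0 : @inner R M i (@coord_curve R M i c t) (pw_coords 0 K 1)
      (pw_coords 0 K 1) < 0.
    rewrite inner_pw !pw_coordsE (cinvK hA)//.
    rewrite mxE big1 => [|k _]; last by rewrite !mxE mulr0.
    have hm : H x (u + t) <= H x t0.
      by apply: hmax; rewrite in_itv/=; apply/andP; split; lra.
    have := ler_norm (H x t0).
    by have := normr_ge0 (H x t0); rewrite /c /K/= !mulr1; lra.
  by split=> //; apply/(future_vector_pw w0); rewrite pw_u_coords.
- by rewrite subr_gt0.
Qed.

Lemma chron_vertical (x : N) v u u' : u < u' ->
  exists w0, forall w, w <= w0 -> chron M (x, v, u) (x, w, u').
Proof.
move=> /(timelike_piece_vertical x v)[w0 pw0]; exists w0 => w ww0.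
have := timelike_piece_vshift (_ : w - w0 <= 0) pw0.
rewrite /vshift /= addr0 [w0 + _]addrC subrK subr_le0 => /(_ ww0).
exact: chron_piece.
Qed.

End PlaneWaveChronology.

(** * The boundary point of a null line *)

Lemma timelike_causal_curve (R : realType) (M : spacetime_data R) (c : R -> M) a b :
  timelike_curve c a b -> causal_curve c a b.
Proof.
elim=> [s t [st [U [d [oU stU sd cd td]]]]|s t u _ IH1 _ IH2]; last exact: t_trans IH1 IH2.
apply: t_step; split=> //; exists U, d; split=> // x sx i ix.
have [w0 wf] := td x sx i ix; split=> //; last exact: ltW.
by apply: contraTneq w0 => ->; rewrite /inner !mul0mx mxE ltxx.
Qed.

Section RayBoundary.
Variables (R : realType) (N : metric_space_data R) (H : N -> R -> R).
Local Notation m := (mdim N).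
Local Notation M := (plane_wave H).
Hypothesis hA : smooth_atlas N.
Hypothesis hH : smooth_profile H.
Implicit Types (p q : M) (x : N) (u v : R).

Lemma vshift0 p : vshift 0 p = p.
Proof. by case: p => -[x v] u; rewrite /vshift /= addr0. Qed.

Lemma vshiftK a p : vshift (- a) (vshift a p) = p.
Proof. by case: p => -[x v] u; rewrite /vshift /= addrK. Qed.

(** Push-up along the null line, which runs to the future as [v] decreases; [chron_raise_v] is the
    dual. *)
Lemma chron_lower_v p x v v' u : v' <= v -> chron M p (x, v, u) -> chron M p (x, v', u).
Proof.
move=> vv' pv; have : chron M (vshift 0 p) (vshift (v' - v) (x, v, u)).
  by apply: chron_vshift pv => //; rewrite subr_le0.
by rewrite vshift0 /vshift /= addrC subrK.
Qed.

Lemma chron_raise_v p x v v' u : v <= v' -> chron M (x, v, u) p -> chron M (x, v', u) p.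
Proof.
move=> vv' pv; have : chron M (vshift (v' - v) (x, v, u)) (vshift 0 p).
  by apply: chron_vshift pv => //; rewrite subr_ge0.
by rewrite vshift0 /vshift /= addrC subrK.
Qed.

Lemma past_nonempty p : exists q, chron M q p.
Proof.
case: p => -[x v] u.
have [|w wP] := @chron_vertical _ _ _ hA hH x 0 (u - 1) u; first by lra.
(* [chron_vertical] prescribes [v] at the start only; a translation in [v] then brings the end to
   the given point. *)
exists (vshift (v - w) (x, 0, u - 1)).
have -> : (x, v, u) = vshift (v - w) ((x, w, u) : M) by rewrite /vshift /= addrC subrK.
by apply: chron_vshift => //; exact: wP.
Qed.

Local Notation ray x u := (range (pw_ray H x u)).

Lemma rayP x u q : ray x u q <-> exists v, q = (x, v, u).
Proof.
split=> [[s _ <-]|[v ->]]; first by exists (- s).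
by exists (- v); rewrite // /pw_ray opprK.
Qed.

Lemma past_rayP x u q : Ipast (chron M) (ray x u) q <-> exists v, chron M q (x, v, u).
Proof.
split=> [[_ /rayP[v ->] qv]|[v qv]]; first by exists v.
by exists (x, v, u) => //; apply/rayP; exists v.
Qed.

Lemma past_ray_IP x u : IP (chron M) (Ipast (chron M) (ray x u)).
Proof.
split.
  split.
    by have [q qx] := past_nonempty (x, 0, u); exists q; apply/past_rayP; exists 0.
  apply/seteqP; split=> q.
    move=> [p px qp]; have [r [_ qr rp]] := chron_dense qp (filterT).
    by exists r => //; exists p.
  by move=> [p [r rx pr] qp]; exists r => //; exact: chron_trans pr.
move=> [P1 [P2 [[_ P1E] [_ P2E] [P1P /nonsubset[p1 [p1P p1N]]]
                [P2P /nonsubset[p2 [p2P p2N]]] PE]]].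
(* The points [p1] and [p2] are missing from [P1] and [P2] respectively. Squeezing both curves to a
   common [u0 < u] and taking the smaller [v] gives a point [q] after both, still in the past of the
   line. Whichever of [P1], [P2] contains [q] then contains its missing point. *)
have [v1 /(chron_squeeze hA hH)[u1 /= u1u h1]] := (past_rayP _ _ _).1 p1P.
have [v2 /(chron_squeeze hA hH)[u2 /= u2u h2]] := (past_rayP _ _ _).1 p2P.
pose u0 := (Num.max u1 u2 + u) / 2.
have mu : Num.max u1 u2 < u by rewrite gt_max u1u u2u.
have m1 : u1 <= Num.max u1 u2 by rewrite le_max lexx.
have m2 : u2 <= Num.max u1 u2 by rewrite le_max lexx orbT.
have u0u : u0 < u by rewrite /u0; lra.
have [|w1 pw1] := h1 u0; first by apply/andP; split; rewrite // /u0; lra.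
have [|w2 pw2] := h2 u0; first by apply/andP; split; rewrite // /u0; lra.
pose q : M := (x, Num.min w1 w2, u0).
have p1q : chron M p1 q by apply: chron_lower_v pw1; rewrite ge_min lexx.
have p2q : chron M p2 q by apply: chron_lower_v pw2; rewrite ge_min lexx orbT.
have : Ipast (chron M) (ray x u) q.
  have [w wP] := chron_vertical hA hH x (Num.min w1 w2) u0u.
  by apply/past_rayP; exists w; exact: wP.
rewrite PE => -[qP|qP].
- by apply: p1N; rewrite P1E; exists q.
- by apply: p2N; rewrite P2E; exists q.
Qed.

(** Each point of the line is followed on the line by a point of [S], and push-up replaces the
    former by the latter. *)
Lemma past_cofinal x u (S : set M) : S `<=` ray x u ->
  (forall v, exists2 v', v' <= v & S (x, v', u)) ->
  Ipast (chron M) S = Ipast (chron M) (ray x u).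
Proof.
move=> Sx cS; apply/seteqP; split=> q; first by move=> [p /Sx px qp]; exists p.
move=> /past_rayP[v qv]; have [v' v'v Sv] := cS v.
by exists (x, v', u) => //; exact: chron_lower_v qv.
Qed.

Lemma all_past_cofinal x u (S : set M) q :
  (forall v, exists2 v', v' <= v & S (x, v', u)) ->
  (forall p, S p -> chron M p q) -> forall p, ray x u p -> chron M p q.
Proof.
move=> cS Sq p /rayP[v ->]; have [v' v'v Sv] := cS v.
by apply: chron_raise_v v'v _; exact: Sq.
Qed.

(** Passes from the whole line, to which the regularity hypothesis refers, to the half line required
    by the definition of null infinity. *)
Lemma future_regular_cofinal x u (S : set M) : S `<=` ray x u ->
  (forall v, exists2 v', v' <= v & S (x, v', u)) ->
  future_regular (chron M) (ray x u) -> future_regular (chron M) S.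
Proof.
move=> Sx cS; rewrite /future_regular (past_cofinal Sx cS) => <-.
congr Ifuture; apply/seteqP; split=> q /= qP; first exact: all_past_cofinal cS qP.
by move=> p /Sx; exact: qP.
Qed.

(* The past of the ray is invariant under translations in v, so if it were the
   past of p, it would also be the past of the translates of p. *)
Lemma past_ray_not_point x u p :
  (Ipast (chron M) [set p] <> Ipast (chron M) [set vshift (-2) p]) ->
  Ipast (chron M) [set p] <> Ipast (chron M) (ray x u).
Proof.
move=> hp pE; apply: hp; rewrite pE; apply/seteqP; split=> q.
  move=> /past_rayP[v qv].
  have : Ipast (chron M) [set p] (vshift 2 q).
    rewrite pE; apply/past_rayP; exists (v + 2).
    exact: (@chron_vshift _ _ _ hA 2 2 q (x, v, u)).
  move=> [_ -> /(chron_vshift hA (lexx (-2)))]; rewrite vshiftK => qp.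
  by exists (vshift (-2) p).
move=> [_ -> qp]; have : Ipast (chron M) (ray x u) (vshift 2 q).
  rewrite -pE; exists p => //.
  by rewrite -[p](vshiftK (-2)) opprK; exact: chron_vshift.
move=> /past_rayP[v /(chron_vshift hA (lexx (-2)))]; rewrite vshiftK => qv.
by apply/past_rayP; exists (v - 2).
Qed.

Lemma ray_boundary_point x u :
  (forall p, Ipast (chron M) [set p] <> Ipast (chron M) [set vshift (-2) p]) ->
  exists2 F, cboundary (chron M) (Ipast (chron M) (ray x u), F) &
    F = set0 \/ S_related (chron M) (Ipast (chron M) (ray x u)) F.
Proof.
move=> hD; set P := Ipast _ _.
have Pnp F : ~ range (point_pair (chron M)) (P, F).
  by move=> [p _ [pE _]]; exact: (past_ray_not_point (hD p) pE).
have [[F PF]|nF] := pselect (exists F, S_related (chron M) P F).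
  by exists F; [split; [apply: Or31|exact: Pnp]|right].
exists set0; last by left.
by split; [apply: Or33; split=> //; exact: past_ray_IP | exact: Pnp].
Qed.

(** Push-up puts each point of the past of the line in the past of [c n] for all large [n]. For the
    future component, regularity identifies the common future of this past with that of the line. *)
Lemma ray_endpoint x u (c : nat -> M) F :
  future_regular (chron M) (ray x u) ->
  completion (chron M) (Ipast (chron M) (ray x u), F) ->
  (F = set0 \/ S_related (chron M) (Ipast (chron M) (ray x u)) F) ->
  (forall n, ray x u (c n)) ->
  (forall v, \forall n \near \oo, (c n).1.2 <= v) ->
  chr_limit (chron M) (fun n => point_pair (chron M) (c n))
    (Ipast (chron M) (ray x u), F).
Proof.
move=> reg cF Frel cx clim; set P := Ipast _ _ in cF Frel *.
have cE n : c n = (x, (c n).1.2, u) by have /rayP[v ->] := cx n.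
split=> //= [_|F0].
  split.
    move=> q /past_rayP[v qv]; have [n _ nP] := clim v.
    exists n => // k nk; exists (c k) => //; rewrite cE.
    by apply: chron_lower_v qv; exact: nP.
  split; first exact: past_ray_IP.
    move=> q /past_rayP[v qv] n _; have [k _ kP] := clim v.
    exists (maxn n k); first by rewrite /= leq_maxl.
    exists (c (maxn n k)) => //; rewrite cE.
    by apply: chron_lower_v qv; apply: kP; rewrite /= leq_maxr.
  move=> Q _ QLS PQ; apply/seteqP; split=> // q /QLS /(_ 0%N I)[k _ [_ -> qk]].
  by exists (c k).
case: Frel => [F00|[_ [FIF FP Fmax]]]; first by move: F0; rewrite F00 => -[].
(* [F] lies in the common future of the past of the line, hence by regularity in that of the
   line. *)
have Fc q : F q -> forall n, chron M (c n) q.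
  move=> /FP; rewrite -reg => -[p pP pq] n; apply: chron_trans pq.
  exact: pP.
split.
  by move=> q Fq; exists 0%N => // n _; exists (c n) => //; exact: Fc.
split=> //.
  by move=> q Fq n _; exists n => //=; exists (c n) => //; exact: Fc.
move=> Q QIF QLS FQ; apply: Fmax => //.
(* A point [p] of [Q] is after [c k] for arbitrarily large [k], so it is after the whole line. Thus
   [Q] lies in the common future, where [F] is maximal. *)
rewrite -reg => q; rewrite QIF.1.2 => -[p Qp pq]; exists p => //.
apply: (@all_past_cofinal x u [set r | ray x u r /\ chron M r p]); last by move=> r [].
move=> v; have [n _ nP] := clim v; have [k nk [_ -> kp]] := QLS p Qp n I.
exists (c k).1.2; first exact: nP.
by rewrite -cE.
Qed.

(** If [p] is after all points of the past of the line, then I^-(s) is contained in I^-(p) for each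
    [s] on the line, and reflection gives that I^+(p) is contained in I^+(s). A point [r] between
    [p] and [q] is therefore after the whole line. *)
Lemma reflecting_future_regular x u :
  reflecting (chron M) -> future_regular (chron M) (ray x u).
Proof.
move=> refl; apply/seteqP; split=> q [p pP pq].
  exists p => // r [s sx rs]; apply: chron_trans rs _; exact: pP.
have [r [_ pr rq]] := chron_dense pq filterT; exists r => // s sx.
have /refl : Ipast (chron M) [set s] `<=` Ipast (chron M) [set p].
  by move=> t [_ -> ts]; exists p => //; apply: pP; exists s.
by move=> /(_ r)[|_ ->//]; exists p.
Qed.

Lemma distinguishing_vshift p : distinguishing (chron M) ->
  Ipast (chron M) [set p] <> Ipast (chron M) [set vshift (-2) p].
Proof.
move=> dist /(dist _ _).1 /(congr1 (fun q : M => q.1.2)) /=; lra.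
Qed.

(** If the pasts agreed, a timelike curve would leave a point near [p], pass near the translate of
    [p] and end at [p], against strong causality. *)
Lemma strongly_causal_vshift p : strongly_causal M ->
  Ipast (chron M) [set p] <> Ipast (chron M) [set vshift (-2) p].
Proof.
move=> sc pE.
(* The level [p.1.2 - 1] lies halfway between [p] and its translate by -2 and gives them disjoint
   neighbourhoods. *)
have pU : \forall q \near p, p.1.2 - 1 < q.1.2.
  have n1 : \forall v \near p.1.2, p.1.2 - 1 < v by apply: lt_nbhsr; lra.
  exact: (@cvg_pw_v _ _ H p _ n1).
have pW : \forall q \near vshift (-2) p, q.1.2 < p.1.2 - 1.
  have n2 : \forall v \near (vshift (-2) p).1.2, v < p.1.2 - 1.
    by apply: lt_nbhsl => /=; lra.
  exact: (@cvg_pw_v _ _ H (vshift (-2) p) _ n2).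
have [V [pV VU scV]] := sc p _ pU.
have [q0 q0p] := past_nonempty p; have [q [Vq _ qp]] := chron_dense q0p pV.
have : Ipast (chron M) [set vshift (-2) p] q by rewrite -pE; exists p.
move=> [_ -> /chron_dense /(_ pW)[r [Wr qr rp']]].
have : Ipast (chron M) [set p] r by rewrite pE; exists (vshift (-2) p).
move=> [_ -> [d [a' [b' [dr dr1 dp]]]]]; move: qr => [c [a [b [cq cq1 cr]]]].
have [|e [b'' [ce /andP[/ltW ab /ltW bb] ea eb eb']]] := timelike_curve_glue cq dr.
  by rewrite cr dr1.
have := scV e a b'' (timelike_causal_curve ce); rewrite ea cq1 eb' dp => /(_ Vq).
move=> /(_ (nbhs_singleton pV) b); rewrite ab bb eb cr => /(_ isT) /=.
by move: Wr => /= /lt_trans h /h; rewrite ltxx.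
Qed.

End RayBoundary.

(** * Null lines are null rays *)

Lemma derive_invariant (R : realType) (V W : normedModType R) (f : V -> W) (y w : V) :
  (forall h : R, f (h *: w + y) = f y) -> 'D_w f y = 0.
Proof.
move=> fE; rewrite /derive (_ : (fun h => _) = cst 0); first exact: lim_cst.
by apply/funext => h; rewrite /= fE subrr scaler0.
Qed.

Section RayGeodesic.
Variables (R : realType) (N : metric_space_data R) (H : N -> R -> R).
Local Notation m := (mdim N).
Local Notation M := (plane_wave H).
Implicit Types (i : idx N) (x : N) (u v : R).

Let iv : 'I_(m + 2) := rshift m (0 : 'I_2).

Lemma pw_metric_vv i y : @metric R M i y iv iv = 0.
Proof.
have e0 : 0 = lshift 1 0 :> 'I_(1 + 1) by exact: val_inj.
rewrite /iv e0 /= /pw_metric.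
rewrite [LHS](@block_mxEdr _ m 2 m 2) [LHS](@block_mxEul _ 1 1 1 1).
by rewrite mxE.
Qed.

Lemma pw_metric_v_invariant i y (h : R) :
  @metric R M i (h *: delta_mx 0 iv + y) = @metric R M i y.
Proof.
rewrite /= /pw_metric /=.
have -> : pw_x (h *: delta_mx 0 iv + y) = pw_x y.
  by apply/rowP => k; rewrite !mxE /= -val_eqE /= addn0 (ltn_eqF (ltn_ord k)) mulr0 add0r.
have -> : pw_u (h *: delta_mx 0 iv + y) = pw_u y.
  by rewrite /pw_u !mxE /iv (inj_eq (@rshift_inj _ _)) /= mulr0 add0r.
by [].
Qed.

(** The metric coefficients do not depend on [v], which kills the first two derivatives; the third
    is a derivative of g_vv = 0. *)
Lemma christoffel_vv i y k : @christoffel R M i y k iv iv = 0.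
Proof.
rewrite /christoffel big1 ?mulr0// => l _.
rewrite [X in _ * (X + _ - _)](_ : _ = 0); last first.
  by apply: derive_invariant => h; rewrite pw_metric_v_invariant.
rewrite [X in _ * (_ + X - _)](_ : _ = 0); last first.
  by apply: derive_invariant => h; rewrite pw_metric_v_invariant.
rewrite [X in _ * (_ - X)](_ : _ = 0); first by rewrite addr0 subr0 mulr0.
by apply: derive_invariant => h; rewrite !pw_metric_vv.
Qed.

(** A reparametrization of [pw_ray] whose half line [s >= 0] starts at an arbitrary point of the
    spacetime. *)
Definition null_line x v u (s : R) : M := (x, v - s, u).

Lemma coord_null_line i x v u : @coord_curve R M i (null_line x v u) =
  fun s => pw_coords (cmap (atlas i) x) v u + s *: pw_coords 0 (-1) 0.
Proof.
by apply/funext => s; rewrite pw_coords_line scaler0 addr0 mulrN1 mulr0 addr0.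
Qed.

(** Reduces the double sum of the geodesic equation to the term treated in [christoffel_vv]. *)
Lemma null_line_velocity (k : 'I_(m + 2)) :
  pw_coords (0 : 'rV[R]_m) (-1) 0 0 k != 0 -> k = iv.
Proof.
have -> : k = @fintype.unsplit m 2 (@fintype.split m 2 k) by rewrite splitK.
case: (@fintype.split m 2 k) => j /=.
  have := congr1 (fun w : 'rV[R]_m => w 0 j) (pw_x_coords (0 : 'rV[R]_m) (-1) 0).
  by rewrite /pw_x !mxE => ->; rewrite eqxx.
have [->//|jn0] := eqVneq j 0.
have -> : j = 1 by apply: val_inj; case: j jn0 => -[|[|]].
by have := pw_u_coords (0 : 'rV[R]_m) (-1) 0; rewrite /pw_u mxE => ->; rewrite eqxx.
Qed.

Lemma null_line_geodesic x v u (b : \bar R) : (0 < b)%E ->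
  null_geodesic (null_line x v u) 0 b.
Proof.
move=> b0; split=> //; exists setT, (null_line x v u); split=> //; first exact: openT.
  move=> t _; split; last first.
    by move=> i k _; rewrite coord_null_line; exact: derivable_derive1n_line.
  have cl : v - s @[s --> t] --> v - t by apply: cvgB; [exact: cvg_cst | exact: cvg_id].
  exact: (cvg_pair (cvg_pair (cvg_cst x) cl) (cvg_cst u)).
move=> t _; split=> i it.
  move=> X k; rewrite /X coord_null_line derive1nS derive1n1 derive1_line derive1_cst.
  rewrite mxE add0r big1 // => a _; rewrite big1 // => c _.
  have [-> | /null_line_velocity ->] := eqVneq (pw_coords (0 : 'rV[R]_m) (-1) 0 0 c) 0.
    by rewrite mulr0.
  have [-> | /null_line_velocity ->] := eqVneq (pw_coords (0 : 'rV[R]_m) (-1) 0 0 a) 0.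
    by rewrite mulr0 mul0r.
  by rewrite christoffel_vv !mul0r.
have -> : derive1 (@coord_curve R M i (null_line x v u)) t = pw_coords 0 (-1) 0.
  by rewrite coord_null_line derive1_line.
split.
- apply/eqP => /(congr1 (@pw_v R N)); rewrite pw_v_coords /pw_v !mxE => /eqP.
  by rewrite oppr_eq0 oner_eq0.
- rewrite inner_pw !pw_coordsE mxE big1 => [|k _]; last by rewrite !mxE mulr0.
  by rewrite !(mulr0, mul0r, addr0).
- by right; exists 1; rewrite ?scale1r.
Qed.

Lemma null_line_inextendible x v u : future_inextendible (null_line x v u) 0 +oo%E.
Proof.
move=> [p /(_ [set q : M | p.1.2 - 1 < q.1.2])[]].
  have n1 : \forall v \near p.1.2, p.1.2 - 1 < v by apply: lt_nbhsr; lra.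
  exact: (@cvg_pw_v _ _ H p _ n1).
(* A time after [s] at which the v-coordinate has dropped to [p.1.2 - 2] or less, outside the chosen
   neighbourhood. *)
move=> s [s0 _] hs; pose t := Num.max (s + 1) (v - p.1.2 + 2).
have st : s + 1 <= t by rewrite /t le_max lexx.
have vt : v - p.1.2 + 2 <= t by rewrite /t le_max lexx orbT.
have := hs t; rewrite /null_line /=.
have l1 : s < t by lra.
have l2 : 0 <= t by lra.
move=> /(_ l1 (conj l2 (ltry _))); lra.
Qed.

(** Achronality: [u] is constant on the line but increases strictly along [chron]. *)
Lemma null_line_ray x v u : smooth_atlas N -> null_ray (null_line x v u) 0 +oo%E.
Proof.
move=> hA; split; first by split; [apply: null_line_geodesic | exact: null_line_inextendible].
by move=> _ _ [s _ <-] [t _ <-] /(chron_u hA); rewrite ltxx.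
Qed.

End RayGeodesic.

(** * Completeness of null geodesics and visibility of every point *)

Lemma inextendible_geodesic_complete (R : realType) (M : spacetime_data R)
    (c : R -> M) (a : R) (b : \bar R) : geodesically_complete M ->
  inextendible_null_geodesic c a b -> b = +oo%E.
Proof.
move=> comp [[ab [U [d [oU abU sd cd gd]]]]].
case: b ab abU cd gd => [b|//|//]; rewrite lte_fin => ab abU cd gd ninext.
exfalso; apply: ninext.
(* If [b] were finite, the geodesic on the open interval would extend past [b], and by continuity
   [f b] would be a limit point contradicting inextendibility. *)
have [||e [[V [f [_ V1 sf ef _]]] ec]] := comp a%:E b%:E c.
- by rewrite lte_fin.
- exists U, d; split=> //.
  + by move=> t [/= t1 t2]; apply: abU; split; rewrite // ltW.
  + by move=> t [/= t1 t2]; apply: cd; split; rewrite // ltW.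
  + by move=> t [/= t1 t2]; have [] := gd t; rewrite // /ico/= ltW.
exists (f b) => W Wb; have [fb _] := sf _ (V1 b I).
have [r /= r0 rW] := (nbhs_ballP _ _).1 (fb _ Wb).
pose s := Num.max a (b - r / 2).
have sa : a <= s by rewrite /s le_max lexx.
have sr : b - r / 2 <= s by rewrite /s le_max lexx orbT.
have sb : s < b by rewrite /s gt_max ab; lra.
exists s; first by split; rewrite // lte_fin.
move=> t st [_ tb]; rewrite -ec ?ef//.
- by apply: rW; rewrite /ball /= ger0_norm; move: tb; rewrite lte_fin => tb; lra.
- by rewrite lte_fin (le_lt_trans sa).
Qed.

(** Common core of both claims: strong causality serves to provide the last hypothesis, and causal
    continuity provides the last two. *)
Lemma no_black_hole (R : realType) (N : metric_space_data R) (H : N -> R -> R) :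
  smooth_atlas N -> smooth_profile H -> [set: N] !=set0 ->
  geodesically_complete (plane_wave H) ->
  (forall x u, future_regular (chron (plane_wave H)) (range (pw_ray H x u))) ->
  (forall p : plane_wave H, Ipast (chron (plane_wave H)) [set p] <>
     Ipast (chron (plane_wave H)) [set vshift (-2) p]) ->
  null_infinity (plane_wave H) !=set0 /\ black_hole (plane_wave H) = set0.
Proof.
move=> hA hH [x0 _] comp reg dist.
(* Every point is itself visible, hence in the causal past of the visible set by reflexivity; the
   point over [x0] also shows that null infinity is not empty. *)
suff vis (p : plane_wave H) : exists c b y,
    [/\ inextendible_null_geodesic c 0 b, c 0 = p, null_infinity (plane_wave H) y &
      future_endpoint c 0 b y].
  split; first by have [c [b [y [_ _ yJ _]]]] := vis (x0, 0, 0); exists y.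
  rewrite -subset0 => p; apply; exists p; last by left.
  by have [c [b [y [c1 c2 c3 c4]]]] := vis p; exists c, 0, b, y.
case: p => -[x v] u; pose c := null_line H x v u.
have [F bF relF] := ray_boundary_point hA hH x u dist.
set P := Ipast _ _ in bF relF.
have rc : c @` ico 0 +oo%E `<=` range (pw_ray H x u).
  by move=> _ [s _ <-]; apply/rayP; exists (v - s).
have ep : future_endpoint c 0 +oo%E (P, F).
  split; first by case: bF.
  move=> t _ t0 tinf; apply: ray_endpoint => //; first by case: bF.
    by move=> n; apply: rc; exists (t n).
  move=> w; have /cvgeyPge /(_ (v - w)) := tinf.
  by apply: filterS => n; rewrite lee_fin /c /null_line /=; lra.
have cray := null_line_ray H x v u hA.
exists c, +oo%E, (P, F); split => //; first by case: cray.
  by rewrite /c /null_line subr0.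
split=> //; last by move=> d a b db _; exact: inextendible_geodesic_complete db.
exists c; split=> //.
apply: (future_regular_cofinal hA rc _ (reg x u)) => w.
(* The minimum with [v] makes the parameter [v - Num.min v w] nonnegative, so the point is on the
   half line. *)
exists (Num.min v w); first by rewrite ge_min lexx orbT.
exists (v - Num.min v w); last by rewrite /c /null_line subKr.
by split; [rewrite subr_ge0 ge_min lexx | exact: ltry].
Qed.

Theorem corollary6p4 (R : realType) (N : metric_space_data R)
    (H : N -> R -> R)
    (hN : riemannian_manifold N) (hNc : geodesically_complete N)
    (hH : smooth_profile H)
    (hL : first_order (chron (plane_wave H))) :
  let M := plane_wave H in
  (strongly_causal M -> geodesically_complete M ->
   (forall x u, future_regular (chron M) (range (pw_ray H x u))) ->
   null_infinity M !=set0 /\ black_hole M = set0)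
  /\
  (causally_continuous (chron M) -> geodesically_complete M ->
   null_infinity M !=set0 /\ black_hole M = set0).
Proof.
move=> M; case: hN => N0 _ _ _ [hA _]; split=> [sc comp reg|[dist refl] comp].
  by apply: no_black_hole => // p; exact: strongly_causal_vshift.
apply: no_black_hole => // [x u|p]; first exact: reflecting_future_regular.
exact: distinguishing_vshift.
Qed.
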